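(* Let $\alpha=\log(1/h)$ and let $c>0$ with $\alpha c<1$. Let $(\delta_n)$ be a sequence of real numbers with $\lim_{n\to\infty}\delta_n(\log n)^{\alpha c}=0$, and define the random set of indices $\mathcal B_n=\{j\le n:\ \xi(S_j,\infty)\ge(1-\delta_n)\lambda_0\log n\}$. Then $$\lim_{n\to\infty}\max_{j\in\mathcal B_n}\max_{|z|\le c\log\log n}\left|\frac{\xi(S_j+z,\infty)}{m_z\lambda_0\log n}-1\right|=0\quad\text{a.s.}$$
   Context: Let $0<q<p<1$ with $p+q=1$, $h=q/p$, $\lambda_0=-1/\log(2q)$. Let $X_1,X_2,\dots$ be i.i.d. with $\mathbf P(X_1=1)=p$, $\mathbf P(X_1=-1)=q$, $S_0=0$, $S_n=X_1+\dots+X_n$. For $z\in\mathbb Z$ let $\xi(z,\infty)=\#\{k\ge1:S_k=z\}$ (finite a.s.). For $z\in\mathbb Z$ put $m_z=h^{|z|}/(2q)$ if $z\ne0$ and $m_0=1$. Indices $j$ range over nonnegative integers and $z$ over integers. *)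

(* Defs.v *)
From HB Require Import structures.
From mathcomp Require Import all_boot all_order all_algebra.
From mathcomp Require Import all_classical all_reals all_analysis.
Set Implicit Arguments. Unset Strict Implicit. Unset Printing Implicit Defensive.
Import Order.TTheory GRing.Theory Num.Theory.
Import numFieldNormedType.Exports.
Local Open Scope classical_set_scope.
Local Open Scope ring_scope.

Section Defs.
Variables (R : realType) (d : measure_display) (T : measurableType d).

(* X i represents the step X_{i+1} of the paper; S n = X_1 + ... + X_n. *)
Definition S (X : nat -> T -> R) (n : nat) (w : T) : R := \sum_(i < n) X i w.

Definition iid_steps (P : probability T R) (X : nat -> T -> R) (p q : R) : Prop :=
  [/\ (forall i, measurable_fun setT (X i)),
      (forall (s : seq nat) (B : nat -> set R), uniq s ->
         (forall i, measurable (B i)) ->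
         P (\bigcap_(i in [set` s]) (X i @^-1` B i)) =
         (\prod_(i <- s) P (X i @^-1` B i))%E),
      (forall i, P (X i @^-1` [set 1]) = p%:E) &
      (forall i, P (X i @^-1` [set -1]) = q%:E)].

(* local time xi(y, oo) = #{k >= 1 : S_k = y}, as a real number
   (the count is a.s. finite; on the null set where it is infinite, fine gives 0). *)
Definition xi (X : nat -> T -> R) (y : R) (w : T) : R :=
  fine (\sum_(1 <= k <oo) ((if S X k w == y then 1 else 0)%:E))%E.

End Defs.

Definition hh {R : realType} (p q : R) : R := q / p.
Definition lambda0 {R : realType} (q : R) : R := - 1 / ln (2 * q).
Definition alpha {R : realType} (p q : R) : R := ln (1 / hh p q).
Definition mz {R : realType} (p q : R) (z : int) : R :=
  if z == 0 then 1 else hh p q ^+ `|z|%N / (2 * q).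

(* Main.v *)
(* Let h = q/p. The walk returns to its current position with probability 2q, so
   P(xi(x) >= u) is about (2q)^u = exp(- u / lambda0), and a union bound over the at
   most 2n+1 positions x with |x| <= n leaves exp(delta_n log n) = exp(o((log n)^(1 - alpha c)))
   for the level (1 - delta_n) lambda0 log n. Given xi(x), the local time xi(x+z)
   concentrates around m_z xi(x), with deviation probability exp(- C h^|z| log n), and
   h^|z| log n >= (log n)^(1 - alpha c) in the window |z| <= c log log n. This beats the
   previous factor, and Borel-Cantelli along the blocks 2^k <= n < 2^(k+1) concludes.

   The joint tail of xi(x) and xi(x+z) comes from Chernoff's inequality. With V equal to a
   at x, to b at x+z and 0 elsewhere, exp(sum_(1 <= i <= k) V(S_i)) f(S_k) is a martingale
   when f = K + (x-returning probability) + beta * ((x+z)-returning probability) and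
   exp(a), exp(b) are chosen accordingly; a small K > 0 bounds f from below. As
   f <= 3, no strong Markov property is needed: the bound is an induction on finite
   sequences of steps. Taking beta = sigma * h^(max(z, 0)) with sigma = tau or - tau, a small
   constant, gives the upper or the lower tail of xi(x+z); sigma = 0 gives that of xi(x). *)
Require Import Defs.
From HB Require Import structures.
From mathcomp Require Import all_boot all_order all_algebra.
From mathcomp Require Import all_classical all_reals all_analysis.
From mathcomp Require Import ring lra zify.
Import Order.TTheory GRing.Theory Num.Theory.
Import numFieldNormedType.Exports.
Local Open Scope classical_set_scope.
Local Open Scope ring_scope.

(** * Exponential moments of local times over finite words *)

Definition step (b : bool) : int := if b then 1 else -1.

Fixpoint words (N : nat) : seq (seq bool) :=
  if N is n.+1
  then map (cons true) (words n) ++ map (cons false) (words n)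
  else [:: [::]].

(** The starting point is not counted, just as [xi] starts at time 1. *)
Fixpoint visits (y : int) (s : seq bool) (x : int) : nat :=
  if s is b :: t then ((y + step b == x)%R + visits (y + step b)%R t x)%N else 0%N.

Lemma visits_shift (a y x : int) (s : seq bool) :
  visits (y + a) s (x + a) = visits y s x.
Proof.
elim: s y => //= b s IH y.
by rewrite addrAC IH (inj_eq (addIr a)).
Qed.

Lemma mem_words (s : seq bool) : s \in words (size s).
Proof.
elim: s => //= b s IH; rewrite mem_cat.
by case: b; rewrite mem_map ?IH ?orbT // => ? ? [].
Qed.

Lemma visitsE (y x : int) (s : seq bool) :
  visits y s x =
  (\sum_(k < size s) (y + \sum_(i < k.+1) step (nth true s i) == x)%R)%N.
Proof.
elim: s y => [|b s IH] y /=; first by rewrite big_ord0.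
rewrite big_ord_recl /= big_ord1 /= IH; congr addn.
apply: eq_bigr => k _.
by rewrite [in RHS]big_ord_recl /= addrA.
Qed.

Definition word_weight {R : pzRingType} (p q : R) (s : seq bool) : R :=
  \prod_(b <- s) (if b then p else q).

Section Chernoff.
Context {R : realFieldType} (p q : R).
Hypotheses (q0 : 0 < q) (qp : q < p) (pq : p + q = 1).

Local Notation h := (q / p).
Local Notation D := (1 - 2 * q).

Let p0 : 0 < p. Proof. exact: lt_trans qp. Qed.
Let h0 : 0 < h. Proof. exact: divr_gt0. Qed.
Let h1 : h < 1. Proof. by rewrite ltr_pdivrMr // mul1r. Qed.
Let D0 : 0 < D. Proof. by move: qp pq; lra. Qed.

(* The probability that the walk started at [y] is at [0] at some time [>= 0]. *)
Definition hitting (y : int) : R := if y is Posz n then h ^+ n else 1.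

(* The probability that the walk started at [y] is at [0] at some time [>= 1]. *)
Definition returning (y : int) : R := hitting y - D * (y == 0)%:R.

Lemma hitting_gt0 y : 0 < hitting y.
Proof. by case: y => n //=; rewrite exprn_gt0. Qed.

Lemma hitting_le1 y : hitting y <= 1.
Proof. by case: y => n //=; rewrite exprn_ile1 // ltW. Qed.

(** One way to reach 0 from [y] is to reach [z] first and 0 afterwards. *)
Lemma hitting_sub y z : hitting z * hitting (y - z) <= hitting y.
Proof.
have [yz|yz] := leP z y; last first.
  apply: (@le_trans _ _ (hitting z)).
    by rewrite ler_piMr ?hitting_le1 // ltW // hitting_gt0.
  case: z yz => // z yz /=; case: y yz => y yz //=.
    by apply: ler_wiXn2l; rewrite ?ltW //; lia.
  by rewrite exprn_ile1 // ltW.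
case: y z yz => [y|y] [z|z] yz.
- have -> : y%:Z - z%:Z = (y - z)%N by lia.
  by rewrite /= -exprD subnKC.
- have -> : y%:Z - Negz z = (y + z.+1)%N by lia.
  by rewrite /= mul1r exprD ler_piMr ?exprn_ge0 ?exprn_ile1 // ltW.
- by [].
- by rewrite [X in X * _]/= mul1r; exact: hitting_le1.
Qed.

(** First-step analysis: at 0 the left side is [p * h + q = 2 * q], and elsewhere [hitting] is
    harmonic. *)
Lemma hitting_harmonic y :
  p * hitting (y + 1) + q * hitting (y - 1) = returning y.
Proof.
have pn0 : p != 0 by rewrite gt_eqF.
have qn0 : q != 0 by rewrite gt_eqF.
have pE : p = 1 - q by move: pq; lra.
rewrite /returning; case: y => [[|n]|n].
- by rewrite add0r sub0r /= expr0 expr1 mulr1 pE; field; rewrite -pE.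
- have -> : (n.+1%:Z + 1)%R = n.+2%:Z by lia.
  have -> : (n.+1%:Z - 1)%R = n%:Z by lia.
  rewrite /= mulr0 subr0 !exprS.
  rewrite (_ : p * _ = (q * h) * h ^+ n); last by field.
  rewrite -mulrDl; congr (_ * _).
  have -> : q * h + q = h * (q + p) by field.
  by rewrite addrC pq mulr1.
- have -> : (Negz n - 1)%R = Negz n.+1 by lia.
  rewrite /= mulr0 subr0.
  case: n => [|n]; first by rewrite /= expr0 !mulr1 pq.
  have -> : (Negz n.+1 + 1)%R = Negz n by lia.
  by rewrite /= !mulr1 pq.
Qed.

Definition excessive (K beta : R) (z y : int) : R :=
  K + returning y + beta * returning (y - z).

Lemma excessiveE K beta z y :
  excessive K beta z y + D * (y == 0)%:R + beta * D * (y == z)%:R =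
  K + hitting y + beta * hitting (y - z).
Proof. by rewrite /excessive /returning subr_eq0; ring. Qed.

Lemma excessive_harmonic K beta z y :
  p * (K + hitting (y + 1) + beta * hitting (y + 1 - z)) +
  q * (K + hitting (y - 1) + beta * hitting (y - 1 - z)) = excessive K beta z y.
Proof.
have E : y + 1 - z = y - z + 1 by rewrite addrAC.
have E' : y - 1 - z = y - z - 1 by rewrite addrAC.
rewrite /excessive -!hitting_harmonic E E'.
have pE : p = 1 - q by move: pq; lra.
rewrite [in X in _ = X + _ + _](_ : K = (p + q) * K); last by rewrite pq mul1r.
ring.
Qed.

Section Exponential.
Context (K sigma : R) (z : int).
Hypotheses (K0 : 0 < K) (K1 : K <= 1) (sq : `|sigma| <= q) (z0 : z != 0).

Local Notation beta := (sigma * hitting z).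
Local Notation f := (excessive K beta z).

(** Ratios of [K + hitting y + beta * hitting (y - z)] to f at [y = 0] and [y = z]: the exp(a) and
    exp(b) of the martingale. *)
Definition tilt0 : R := (f 0 + D) / f 0.
Definition tiltz : R := (f z + beta * D) / f z.

Lemma returning_ge y : 2 * q * hitting y <= returning y.
Proof.
rewrite /returning; case: eqVneq => [->|_] /=; first by rewrite expr0; lra.
rewrite mulr0 subr0 ler_piMl ?ltW ?hitting_gt0 //; move: D0; lra.
Qed.

Lemma returning_le y : returning y <= hitting y.
Proof. by rewrite /returning gerBl mulr_ge0 // ltW. Qed.

(** The factor [hitting z] in [beta] serves this bound, through [hitting_sub]. Since [returning y]
    is at least [2 * q * hitting y], the term of f that may be negative is at most half of the
    positive one. *)
Lemma norm_beta_returning y :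
  `|beta * returning (y - z)| <= q * hitting y.
Proof.
have r0 : 0 <= returning (y - z).
  apply: le_trans (returning_ge _); rewrite !mulr_ge0 ?ltW ?hitting_gt0 //.
rewrite !normrM (ger0_norm r0) (gtr0_norm (hitting_gt0 z)) -mulrA.
apply: ler_pM => //; first by rewrite mulr_ge0 // ltW // hitting_gt0.
apply: le_trans (hitting_sub _ z); rewrite ler_pM2l ?hitting_gt0 //.
exact: returning_le.
Qed.

Lemma excessive_ge y : K <= f y.
Proof.
have := norm_beta_returning y; rewrite ler_norml => /andP[+ _].
have := returning_ge y; have := hitting_gt0 y; have := q0.
rewrite /excessive; move: (beta * _) (returning _) (hitting _) => b r t.
move=> q1 t0 rt; have : 0 < q * t by exact: mulr_gt0.
move: rt; rewrite -mulrA; move: (q * t) => u; lra.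
Qed.

Lemma excessive_gt0 y : 0 < f y.
Proof. exact: lt_le_trans (excessive_ge y). Qed.

Lemma excessive_le3 y : f y <= 3.
Proof.
have := norm_beta_returning y; rewrite ler_norml => /andP[_].
have := returning_le y; have := hitting_le1 y; have := hitting_gt0 y.
rewrite /excessive; move: (beta * _) (returning _) (hitting _) => b r t.
move=> t0 t1 rt bt; have : q * t <= 1.
  by apply: mulr_ile1 => //; move: qp pq q0 t0; lra.
move: K1; lra.
Qed.

Lemma tilt_gt0 : 0 < tilt0 /\ 0 < tiltz.
Proof.
have f0 := excessive_gt0 0; have fz := excessive_gt0 z; split.
  by rewrite divr_gt0 // addr_gt0.
rewrite divr_gt0 //.
(* The numerator of [tiltz] is [K + hitting z + beta], positive because [sigma > -1]. *)
have := excessiveE K beta z z; rewrite eqxx (negbTE z0) /= mulr0 addr0 mulr1.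
move=> ->; rewrite subrr /= expr0 mulr1 -addrA ltr_wpDr //.
have : - sigma < 1.
  have := sq; rewrite ler_norml => /andP[+ _]; move: qp pq; lra.
rewrite -[X in X + _]mul1r -mulrDl => s1.
by rewrite mulr_ge0 ?ltW ?hitting_gt0 //; lra.
Qed.

(** The tilt at [y] turns f into a function whose average over the next position is f at the current
    one, by [excessive_harmonic]. *)
Lemma tilt_excessive y :
  tilt0 ^+ (y == 0) * tiltz ^+ (y == z) * f y = K + hitting y + beta * hitting (y - z).
Proof.
have f0 := excessive_gt0 0; have fz := excessive_gt0 z.
rewrite -excessiveE /tilt0 /tiltz; case: (eqVneq y 0) => [->|y0] /=.
  rewrite eq_sym (negbTE z0) /= expr1 expr0 mulr1 mulr0 addr0 mulr1.
  by rewrite divfK // gt_eqF.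
case: (eqVneq y z) => [->|yz] /=.
  by rewrite expr1 expr0 mul1r mulr0 addr0 mulr1 divfK // gt_eqF.
by rewrite !expr0 !mul1r !mulr0 !addr0.
Qed.

Lemma word_weight_cons b s :
  word_weight p q (b :: s) = (if b then p else q) * word_weight p q s.
Proof. by rewrite /word_weight big_cons. Qed.

(* The exponential of the local times at [0] and [z], weighted by the excessive
   function at the current position, is a martingale; it dominates [K] times
   that exponential. *)
Lemma words_exponential N y :
  \sum_(s <- words N) word_weight p q s *
     (tilt0 ^+ visits y s 0 * tiltz ^+ visits y s z * K) <= f y.
Proof.
have [t0 tz] := tilt_gt0.
elim: N y => [|N IH] y /=.
  by rewrite big_seq1 /word_weight big_nil /= !expr0 !mul1r excessive_ge.
(* Contribution of the words with first letter [b]; the visit made by that step supplies the factor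
   in [tilt_excessive]. *)
have aux b : \sum_(s <- map (cons b) (words N)) word_weight p q s *
     (tilt0 ^+ visits y s 0 * tiltz ^+ visits y s z * K) <=
     (if b then p else q) *
     (K + hitting (y + step b) + beta * hitting (y + step b - z)).
  rewrite big_map -tilt_excessive.
  rewrite (eq_bigr (fun s => (if b then p else q) *
      (tilt0 ^+ (y + step b == 0) * tiltz ^+ (y + step b == z)) *
      (word_weight p q s * (tilt0 ^+ visits (y + step b) s 0 *
         tiltz ^+ visits (y + step b) s z * K)))); last first.
    by move=> s _; rewrite word_weight_cons /= !exprD; ring.
  rewrite -mulr_sumr [leRHS]mulrA ler_wpM2l ?IH //.
  by rewrite !mulr_ge0 ?exprn_ge0 ?ltW //; case: b => //; exact: ltW.
rewrite big_cat /= -excessive_harmonic; exact: lerD (aux true) (aux false).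
Qed.

(** Markov's inequality. Starting from [- x] moves the two sites to 0 and [z], and the bound 3 on f
    makes the estimate uniform in [x] and in the length [N]. *)
Lemma words_chernoff N x (E : R) (Q : pred (seq bool)) : 0 < E ->
  (forall s, Q s -> E <= tilt0 ^+ visits 0 s x * tiltz ^+ visits 0 s (x + z)) ->
  \sum_(s <- words N | Q s) word_weight p q s <= 3 / (K * E).
Proof.
move=> E0 QE; have [t0 tz] := tilt_gt0.
have w0 s : 0 <= word_weight p q s.
  by apply: prodr_ge0 => -[] _; exact: ltW.
rewrite ler_pdivlMr ?mulr_gt0 //.
apply: (le_trans _ (excessive_le3 (- x))).
apply: le_trans (words_exponential N (- x)).
rewrite mulr_suml big_mkcond /=; apply: ler_sum => s _.
have := QE s; rewrite -(visits_shift (- x) 0 x) -(visits_shift (- x) 0 (x + z)).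
rewrite subrr add0r addrAC subrr add0r; case: ifP => [_ /(_ isT) H|_ _].
  by rewrite ler_wpM2l // mulrC ler_wpM2r // ltW.
by rewrite !mulr_ge0 ?exprn_ge0 //; exact: ltW.
Qed.

End Exponential.
End Chernoff.

(** * From words to events *)

(** Borel-Cantelli, with a bound shaped to telescope: the partial sums stay below [C]. *)
Lemma ae_near_notin (R : realType) (d : measure_display) (T : measurableType d)
    (P : probability T R) (F : nat -> set T) (C : R) :
  (forall n, measurable (F n)) ->
  (\forall n \near \oo, (P (F n) <= (C / (n.+1%:R * n.+2%:R))%:E)%E) ->
  {ae P, forall w, \forall n \near \oo, ~ F n w}.
Proof.
move=> mF [n0 _ PF].
(* The bound holds only from [n0] on; earlier events are emptied so that the whole series can be
   summed. *)
pose G n := if (n0 <= n)%N then F n else set0.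
have mG n : measurable (G n) by rewrite /G; case: ifP.
have C0 : 0 <= C.
  have := PF n0 (leqnn n0); move/(le_trans (measure_ge0 _ _)).
  by rewrite lee_fin pmulr_lge0 // invr_gt0 mulr_gt0 // ltr0n.
have PG n : (P (G n) <= (C * (n.+1%:R^-1 - n.+2%:R^-1))%:E)%E.
  have E : n.+1%:R^-1 - n.+2%:R^-1 = (n.+1%:R * n.+2%:R)^-1 :> R.
    have n1 : n.+1%:R != 0 :> R by rewrite pnatr_eq0.
    have n2 : n.+1%:R + 1 != 0 :> R by rewrite natr1 pnatr_eq0.
    rewrite -[n.+2%:R]natr1; move: (n.+1%:R) n1 n2 => a a0 a1.
    by field; rewrite a0 a1.
  rewrite E /G; case: ifP => [/PF //|_].
  by rewrite measure0 lee_fin divr_ge0 // mulr_ge0.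
have sumG : (\sum_(n <oo) P (G n) < +oo)%E.
  apply: (@le_lt_trans _ _ (C%:E)%E); last by rewrite ltry.
  apply: lime_le; first exact: is_cvg_nneseries.
  apply: nearW => n; apply: (@le_trans _ _ (C * (1 - n.+1%:R^-1))%:E)%E.
    elim: n => [|n IH]; first by rewrite big_geq // invr1 subrr mulr0.
    rewrite big_nat_recr //=; apply: le_trans (leeD IH (PG n)) _.
    by rewrite -EFinD lee_fin -mulrDr subrKA.
  by rewrite lee_fin ler_piMr // gerBl invr_ge0.
have L0 := lim_sup_set_cvg0 mG sumG.
have mL : measurable (lim_sup_set G).
  by apply: bigcap_measurable => // n _; apply: bigcup_measurable.
exists (lim_sup_set G); split => // w /= nw.
move=> n _; apply: contrapT => H; apply: nw.
exists (maxn n n0) => //= k; rewrite /= geq_max => /andP[nk n0k] Fk; apply: H.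
by exists k => //; rewrite /G n0k.
Qed.

Section Steps.
Context {R : realType} {d : measure_display} {T : measurableType d}.
Context (P : probability T R) (X : nat -> T -> R) (p q : R).
Hypothesis hX : iid_steps P X p q.

Definition cylinder (s : seq bool) : set T :=
  \bigcap_(i in [set` iota 0 (size s)]) X i @^-1` [set (step (nth true s i))%:~R].

Lemma measurable_cylinder s : measurable (cylinder s).
Proof.
case: hX => mX _ _ _; apply: bigcap_measurableType => i _.
by rewrite -[_ @^-1` _]setTI; apply: mX.
Qed.

Lemma probability_cylinder s : P (cylinder s) = (word_weight p q s)%:E.
Proof.
case: hX => mX ind P1 Pm.
rewrite /cylinder (ind _ (fun i => [set (step (nth true s i))%:~R])) ?iota_uniq //.
rewrite /word_weight -prodEFin.
rewrite [in RHS](big_nth true) /index_iota subn0; apply: eq_bigr => i _.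
by case: nth; [exact: P1|exact: Pm].
Qed.

Definition word_event (N : nat) (Q : pred (seq bool)) : set T :=
  \big[setU/set0]_(s <- words N | Q s) cylinder s.

Lemma measurable_word_event N Q : measurable (word_event N Q).
Proof. by apply: bigsetU_measurable => s _; exact: measurable_cylinder. Qed.

Lemma probability_word_event N Q :
  (P (word_event N Q) <= (\sum_(s <- words N | Q s) word_weight p q s)%:E)%E.
Proof.
rewrite /word_event; elim: (words N) => [|s r IH].
  by rewrite !big_nil measure0.
rewrite !big_cons; case: ifP => // _.
apply: le_trans (measureU2 _ _ _) _; first exact: measurable_cylinder.
  by apply: bigsetU_measurable => t _; exact: measurable_cylinder.
by rewrite EFinD; apply: leeD => //; rewrite -probability_cylinder.
Qed.

(** The limit inferior of the prefix events: a lower bound on an infinite local time is read off all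
    long enough prefixes. *)
Definition eventual_event (Q : pred (seq bool)) : set T :=
  \bigcup_N \bigcap_(n in [set n | (N <= n)%N]) word_event n Q.

Lemma measurable_eventual_event Q : measurable (eventual_event Q).
Proof.
apply: bigcup_measurable => N _; apply: bigcap_measurableType => n _.
exact: measurable_word_event.
Qed.

(** The inner intersections increase with [N] and each lies in one word event, so continuity from
    below carries the uniform bound to the limit. *)
Lemma probability_eventual_event Q (C : R) :
  (forall N, \sum_(s <- words N | Q s) word_weight p q s <= C) ->
  (P (eventual_event Q) <= C%:E)%E.
Proof.
move=> QC; pose G N := \bigcap_(n in [set n | (N <= n)%N]) word_event n Q.
have mG N : measurable (G N).
  by apply: bigcap_measurableType => n _; exact: measurable_word_event.
have cG : (P \o G) x @[x --> \oo] --> P (\bigcup_N G N).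
  apply: nondecreasing_cvg_mu => //; first exact: measurable_eventual_event.
  move=> m n mn; apply/subsetPset => w Gm k /= nk; apply: Gm.
  exact: leq_trans nk.
rewrite /eventual_event -(cvg_lim _ cG) //.
apply: lime_le; first by apply/cvg_ex; exists (P (\bigcup_N G N)).
apply: nearW => N /=.
apply: (@le_trans _ _ (P (word_event N Q))).
  apply: le_measure; rewrite ?inE //; first exact: measurable_word_event.
  by move=> w; apply => /=.
by apply: le_trans (probability_word_event _ _) _; rewrite lee_fin.
Qed.

Definition regular (w : T) : Prop := forall i, X i w = 1 \/ X i w = -1.

Definition signs (w : T) (N : nat) : seq bool := mkseq (fun i => X i w == 1) N.

Lemma ae_regular : p + q = 1 -> {ae P, forall w, regular w}.
Proof.
move=> pq; case: hX => mX _ P1 Pm; apply: ae_foralln => i.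
have m1 (a : R) : measurable (X i @^-1` [set a]).
  by rewrite -[_ @^-1` _]setTI; apply: mX.
have D : [disjoint X i @^-1` [set 1] & X i @^-1` [set -1]].
  apply/disj_setPS => w [/= ->] H; exfalso; move: H; lra.
pose A := X i @^-1` [set 1] `|` X i @^-1` [set -1].
have mA : measurable A by exact: measurableU.
have PA : P A = 1%E.
  rewrite -[1%E]/(1%:E) -pq EFinD -(P1 i) -(Pm i); apply: measureU => //.
  by apply/eqP; rewrite -disj_set2E.
have PAC : P (~` A) = 0 by rewrite probability_setC // PA subee.
exists (~` A); split => //; first exact: measurableC.
Qed.

Lemma step_sign w i : regular w -> X i w = (step (X i w == 1))%:~R.
Proof.
move=> /(_ i) [->|->]; first by rewrite eqxx.
by case: eqP => // H; exfalso; move: H; lra.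
Qed.

Definition position (w : T) (k : nat) : int :=
  \sum_(i < k) step (X i w == 1).

Lemma S_position w k : regular w -> S X k w = (position w k)%:~R.
Proof.
move=> rw; rewrite /S /position rmorph_sum /=; apply: eq_bigr => i _.
exact: step_sign.
Qed.

Lemma norm_position w k : `|position w k| <= k%:Z.
Proof.
rewrite /position; elim: k => [|k IH]; first by rewrite big_ord0.
rewrite big_ord_recr /=; apply: le_trans (ler_normD _ _) _.
have : `|step (X k w == 1)| = 1 by case: (_ == _).
by move=> ->; rewrite -addn1 PoszD lerD2r.
Qed.

Lemma visits_signs w N x :
  (visits 0 (signs w N) x)%:R =
  \sum_(1 <= k < N.+1) (position w k == x)%:R :> R.
Proof.
rewrite visitsE natr_sum big_add1 /= big_mkord size_mkseq.
apply: eq_bigr => k _; rewrite add0r; congr ((_ == _)%:R).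
apply: eq_bigr => i _; rewrite nth_mkseq //.
exact: leq_trans (ltn_ord i) (ltn_ord k).
Qed.

Lemma mem_word_event w N (Q : pred (seq bool)) : regular w -> Q (signs w N) -> word_event N Q w.
Proof.
move=> rw Qs; rewrite /word_event.
have: signs w N \in words N by rewrite -[X in words X](size_mkseq (fun i => X i w == 1)) mem_words.
elim: (words N) => // s r IH; rewrite inE big_cons => /orP[/eqP <-|/IH H].
  rewrite Qs; left => i /=; rewrite mem_iota add0n size_mkseq /= => iN.
  by rewrite nth_mkseq //; exact: step_sign.
by case: ifP => // _; right.
Qed.

(** Left in the extended reals: [fine] sends an infinite count to 0 and would break the comparison
    with prefix counts. *)
Definition local_time (w : T) (x : int) : \bar R :=
  (\sum_(1 <= k <oo) ((position w k == x)%:R)%:E)%E.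

Lemma xi_local_time w x : regular w -> xi X x%:~R w = fine (local_time w x).
Proof.
move=> rw; rewrite /xi /local_time; congr fine; apply: eq_eseriesr => k _.
by rewrite S_position // eqr_int; case: eqP.
Qed.

Lemma visits_le_local_time w N x :
  (((visits 0 (signs w N) x)%:R : R)%:E <= local_time w x)%E.
Proof.
by rewrite visits_signs -sumEFin; apply: nneseries_lim_ge => k _ _; rewrite lee_fin.
Qed.

Lemma visits_signs_mono w x m n : (m <= n)%N ->
  (visits 0 (signs w m) x <= visits 0 (signs w n) x)%N.
Proof.
move=> mn; rewrite -(ler_nat R) !visits_signs [leRHS](big_cat_nat (n := m.+1)) //=.
by rewrite lerDl sumr_ge0.
Qed.

(** Prefix counts are integers: if all are below [r], all are at most [Num.ceil r - 1 < r], and so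
    is their limit. Hence [r] cannot be attained in the limit only. *)
Lemma visits_ge_near w x (r : R) : (r%:E <= local_time w x)%E ->
  \forall N \near \oo, r <= (visits 0 (signs w N) x)%:R.
Proof.
move=> rl; have [[N rN]|H] := pselect (exists N, r <= (visits 0 (signs w N) x)%:R).
  exists N => // n /= Nn; apply: le_trans rN _.
  by rewrite ler_nat visits_signs_mono.
have {}H N : (visits 0 (signs w N) x)%:R <= (Num.ceil r - 1)%:~R :> R.
  rewrite pmulrn ler_int lerBrDr lezD1 ceil_gt_int -pmulrn ltNge.
  by apply/negP => rv; apply: H; exists N.
have : (local_time w x <= (Num.ceil r - 1)%:~R%:E)%E.
  apply: lime_le; first by apply: is_cvg_nneseries => n _ _; rewrite lee_fin.
  apply: nearW => -[|n].
    rewrite big_geq //; apply: le_trans (_ : (0 <= ((visits 0 (signs w 0) x)%:R : R)%:E)%E) _.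
      by rewrite lee_fin.
    by rewrite lee_fin.
  by rewrite sumEFin -visits_signs lee_fin.
move=> /(le_trans rl); rewrite lee_fin leNgt => /negP; case.
by rewrite -ceil_gt_int ltrBlDr ltrDl.
Qed.

End Steps.

(** * Estimates of the exponents *)

Section RealInequalities.
Context {R : realType}.
Implicit Types (x y q K : R).

(** [le_ln1Dx] at [- (x / (1 + x))] bounds [ln (1 + x)] below by [x / (1 + x)]; then
    [1 + x >= 1 / 2] is used. *)
Lemma ln1D_ge x : - (1 / 2) <= x -> x - 2 * x ^+ 2 <= ln (1 + x).
Proof.
move=> hx; have x1 : 0 < 1 + x by move: hx; lra.
have xn : 1 + x != 0 by rewrite gt_eqF.
have E : 1 + (- (x / (1 + x))) = (1 + x)^-1 by field.
have := @le_ln1Dx R (- (x / (1 + x))); rewrite -subr_gt0 opprK addrC E invr_gt0.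
move=> /(_ x1); rewrite lnV ?posrE // lerN2; apply: le_trans.
have := sqr_ge0 x; rewrite ler_pdivlMr //; move: hx.
nra.
Qed.

Lemma ln_div_ge x y : - (1 / 2) <= x -> -1 < y ->
  x - y - 2 * x ^+ 2 <= ln ((1 + x) / (1 + y)).
Proof.
move=> hx hy; rewrite ln_div ?posrE; [|by move: hx; lra|by move: hy; lra].
by have := ln1D_ge x hx; have := le_ln1Dx hy; lra.
Qed.

(** One term of the exponential series, of order at least [4 / t], is enough. In the union bound the
    fourth power pays for the factor 1/K and for the number of offsets [z], and leaves a summable
    inverse square. *)
Lemma expR_stretched_decay (c t : R) : 0 < c -> 0 < t ->
  exists C, forall x, 1 <= x -> expR (- (c * x `^ t)) <= C / x ^+ 4.
Proof.
move=> c0 t0; pose m := Num.truncn (4 / t).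
have mt : 4 <= m.+1%:R * t.
  rewrite -ler_pdivrMr //; apply/ltW.
  by have := truncnS_gt (4 / t).
exists (m.+1`!%:R / c ^+ m.+1) => x x1.
have x0 : 0 < x by exact: lt_le_trans x1.
have y0 : 0 < c * x `^ t by rewrite mulr_gt0 // powR_gt0.
have F0 : 0 < m.+1`!%:R :> R by rewrite ltr0n fact_gt0.
have := expR_ge1Dxn m (ltW y0).
rewrite exprMn -[(x `^ t) ^+ _]powR_mulrn ?powR_ge0 // -powRrM => H.
have x4 : x ^+ 4 <= x `^ (t * m.+1%:R).
  by rewrite -powR_mulrn ?(ltW x0) // ler_powR // mulrC.
rewrite expRN invf_ple ?posrE ?expR_gt0 //; last first.
  by rewrite !divr_gt0 ?exprn_gt0.
rewrite invf_div [x ^+ 4 / _]mulrC invf_div.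
apply: (@le_trans _ _ (c ^+ m.+1 / m.+1`!%:R * x `^ (t * m.+1%:R))).
  by rewrite ler_wpM2l // divr_ge0 // ltW // exprn_gt0.
rewrite mulrAC; move: H; lra.
Qed.

(* In this lemma and the next two, [D] is [1 - 2 * q], [n0] and [n1] are the local
   times at the two sites, [a] and [b] the logarithms of the tilting parameters and
   [m * H] the value around which [n1] should concentrate. *)
Lemma neighbour_exponent_ge (D tau sigma e k K m H b n1 : R) :
  0 < D -> D <= 1 -> 0 < e -> e <= 1 -> 0 < tau -> tau <= 1 / 16 ->
  tau <= D * e / 16 -> `|sigma| = tau ->
  0 < K -> 0 < H -> 0 <= k -> k * H <= K -> 0 <= m ->
  D * (sigma / (1 + k)) - 2 * (sigma / (1 + k)) ^+ 2 <= b -> 0 <= n1 ->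
  (0 < sigma -> (1 + e) * (m * H) <= n1) ->
  (sigma < 0 -> n1 <= (1 - e) * (m * H)) ->
  m * (H * (D * sigma + e * D * tau - 4 * tau ^+ 2) - 2 * K) <= b * n1.
Proof.
move=> D0 D1 e0 e1 tau0 t16 tauD sE K0 H0 k0 kH m0.
set s' := sigma / (1 + k); set v := m * H.
move=> b_ge n1_ge0 n1p n1m.
have v0 : 0 <= v by rewrite mulr_ge0 // ltW.
have vE : v = m * H by [].
have k1 : 0 < 1 + k by rewrite ltr_wpDr.
have tauk : `|s'| = tau / (1 + k) by rewrite normrM sE gtr0_norm // invr_gt0.
pose t' := tau / (1 + k).
have t'0 : 0 < t' by rewrite divr_gt0.
have tk : 0 <= tau * k by rewrite mulr_ge0 // ltW.
have t't : t' <= tau by rewrite ler_pdivrMr // mulrDr mulr1 lerDl.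
(* Replacing [t'] by [tau] costs at most [tau * k]; after multiplication by [v], the bound
   [k * H <= K] absorbs this into [m * K]. *)
have t'k : tau - t' <= tau * k.
  have -> : tau - t' = t' * k by rewrite /t'; field; rewrite gt_eqF.
  by rewrite ler_wpM2r.
have tk' : tau * k <= k.
  by apply: ler_piMl => //; move: t16; clear; lra.
have s'2 : s' ^+ 2 = t' ^+ 2 by rewrite -real_normK ?num_real // tauk.
have t2 : t' ^+ 2 <= tau ^+ 2 by rewrite ler_sqr ?nnegrE // ltW.
have t'2 : 0 <= t' ^+ 2 by exact: sqr_ge0.
have vk : v * k <= m * K by rewrite /v -mulrA ler_wpM2l // mulrC.
have De : D * e <= D by rewrite ler_piMr // ltW.
have [sg0|sg0] : 0 < sigma \/ sigma < 0.
  have : sigma != 0 by rewrite -normr_gt0 sE.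
  by rewrite neq_lt => /orP[]; [right|left].
(* Upper tail: the lower bound for [b] is nonnegative, so it combines with the lower bound for
   [n1]. *)
- have sgE : sigma = tau by rewrite -sE gtr0_norm.
  have s'E : s' = t' by rewrite /s' sgE.
  have b0 : 0 <= D * t' - 2 * t' ^+ 2.
    have : t' * (D - 2 * t') >= 0.
      by apply: mulr_ge0; [exact: ltW|move: t't tauD De D0; clear; lra].
    by rewrite mulrBr; clear; lra.
  have : (D * t' - 2 * t' ^+ 2) * ((1 + e) * v) <= b * n1.
    apply: ler_pM => //; [|by rewrite -s'E|exact: n1p].
    by apply: mulr_ge0 => //; move: e0; clear; lra.
  apply: le_trans; rewrite sgE.
  have A1 : D * t' * (1 + e) - 4 * tau ^+ 2 <= (D * t' - 2 * t' ^+ 2) * (1 + e).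
    have : e * t' ^+ 2 <= t' ^+ 2 by rewrite ler_piMl.
    by move: t2; clear; lra.
  have A2 : D * tau * (1 + e) - 2 * k <= D * t' * (1 + e).
    suff : D * (1 + e) * (tau - t') <= 2 * (tau * k) by move: tk'; clear; lra.
    apply: ler_pM => //; last by move: De D1; clear; lra.
      by apply: mulr_ge0; [exact: ltW|move: e0; clear; lra].
    by rewrite subr_ge0.
  have : v * (D * tau * (1 + e) - 2 * k - 4 * tau ^+ 2) <=
         v * ((D * t' - 2 * t' ^+ 2) * (1 + e)).
    by apply: ler_wpM2l => //; move: A1 A2; clear; lra.
  by move: vk; rewrite vE; clear; lra.
(* Lower tail: the lower bound for [b] is negative, so it combines with the upper bound for [n1]. *)
- have sgE : sigma = - tau by rewrite -sE ltr0_norm ?opprK.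
  have s'E : s' = - t' by rewrite /s' sgE mulNr.
  have : (- (D * t') - 2 * t' ^+ 2) * ((1 - e) * v) <= b * n1.
    apply: (@le_trans _ _ ((- (D * t') - 2 * t' ^+ 2) * n1)).
      rewrite ler_wnM2l ?n1m //.
      by have := mulr_gt0 D0 t'0; move: t'2; clear; lra.
    by apply: ler_wpM2r => //; move: b_ge; rewrite s'2 s'E mulrN.
  apply: le_trans; rewrite sgE.
  have Dt : D * t' <= D * tau by rewrite ler_wpM2l // ltW.
  have A1 : v * ((- (D * tau) - 2 * tau ^+ 2) * (1 - e)) <=
            v * ((- (D * t') - 2 * t' ^+ 2) * (1 - e)).
    apply: ler_wpM2l => //; apply: ler_wpM2r; first by move: e1; clear; lra.
    by move: Dt t2; clear; lra.
  have A2 : 0 <= v * tau ^+ 2 * (1 + e).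
    by apply: mulr_ge0; [apply: mulr_ge0 => //; exact: sqr_ge0|move: e0; clear; lra].
  have A3 : 0 <= m * K by rewrite mulr_ge0 // ltW.
  by move: A1 A2 A3; rewrite vE; clear; lra.
Qed.

Lemma origin_exponent_ge (q D tau sigma e K H lam l dl a n0 : R) :
  0 < q -> D = 1 - 2 * q -> 0 < D -> 0 < lam -> lam * D <= 1 ->
  e <= 1 -> 0 < tau -> tau <= q / 16 -> tau <= D * e / 16 -> `|sigma| = tau ->
  0 < K -> K <= tau -> 0 < H -> H <= 1 -> 0 <= l -> 0 <= dl -> dl <= 1 ->
  lam^-1 - (K + sigma * H) * D / (2 * q) - 2 * (K + sigma * H) ^+ 2 <= a ->
  (1 - dl) * lam * l <= n0 ->
  l - lam * l / (2 * q) * (D * K + D * sigma * H + 4 * K + 4 * tau ^+ 2 * H)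
    - 2 * dl * l <= a * n0.
Proof.
move=> q0 DE D0 lam0 lamD e1 tau0 tauq tauD sE K0 Kt H0 H1 l0 d0 d1.
set x := K + sigma * H; set m := lam * l / (2 * q) => a_ge n0_ge.
have q1 : q <= 1 / 2 by move: D0; rewrite DE; clear; lra.
have t16 : tau <= 1 / 16 by move: tauq q1; clear; lra.
have q2 : 0 < 2 * q by rewrite mulr_gt0.
have m0 : 0 <= m by rewrite /m divr_ge0 ?mulr_ge0 // ltW.
have x2 : x ^+ 2 <= 2 * K + 2 * tau ^+ 2 * H.
  have s2 : sigma ^+ 2 = tau ^+ 2 by rewrite -sE real_normK ?num_real.
  have h1 : sigma ^+ 2 * H ^+ 2 <= tau ^+ 2 * H.
    by rewrite s2 ler_wpM2l ?sqr_ge0 // expr2 ler_piMl // ltW.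
  have h2 : K ^+ 2 <= K.
    by rewrite expr2 ler_piMl ?(ltW K0) //; move: Kt t16; clear; lra.
  by have := sqr_ge0 (K - sigma * H); rewrite /x; move: h1 h2; clear; lra.
have xle : `|x| <= 2 * tau.
  rewrite /x; apply: le_trans (ler_normD _ _) _.
  rewrite normrM sE (gtr0_norm K0) (gtr0_norm H0).
  have : tau * H <= tau by rewrite ler_piMr // ltW.
  by move: Kt; clear; lra.
have De : D * e <= D by rewrite ler_piMr // ltW.
have x22 : 2 * x ^+ 2 <= D / 2.
  have h1 : x ^+ 2 <= (2 * tau) ^+ 2.
    rewrite -[x ^+ 2]real_normK ?num_real // ler_sqr ?nnegrE //.
    by rewrite mulr_ge0 // ltW.
  have h2 : tau ^+ 2 <= tau / 16.
    by rewrite expr2 ler_pM2l //; move: t16; clear; lra.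
  by move: h1 h2 tauD De tau0; clear; lra.
have xD : `|x * D / (2 * q)| <= D / 16.
  rewrite !normrM normfV (gtr0_norm D0) (gtr0_norm q2) ler_pdivrMr //.
  have : `|x| * D <= q / 8 * D.
    by rewrite ler_wpM2r ?(ltW D0) //; move: xle tauq; clear; lra.
  by clear; lra.
move: xD; rewrite ler_norml => /andP[xDl xDu].
(* A nonnegative lower bound for [a]; the estimate [a0 * lam <= 2] below is the price of the loss
   [dl] in the level. *)
pose a0 := lam^-1 - x * D / (2 * q) - 2 * x ^+ 2.
have lamV : D <= lam^-1 by rewrite -[leRHS]mul1r ler_pdivlMr // mulrC.
have a00 : 0 <= a0 by rewrite /a0; move: lamV xDu x22 D0; clear; lra.
have a02 : a0 * lam <= 2.
  have : a0 <= lam^-1 + D / 16.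
    by rewrite /a0; have := sqr_ge0 x; move: xDl; clear; lra.
  move=> /(ler_wpM2r (ltW lam0)); rewrite [leRHS]mulrDl mulVf ?gt_eqF //.
  by move: lamD; clear; lra.
apply: (@le_trans _ _ (a0 * ((1 - dl) * lam * l))); last first.
  apply: (@le_trans _ _ (a0 * n0)); first by rewrite ler_wpM2l.
  apply: ler_wpM2r => //; apply: le_trans n0_ge.
  by apply: mulr_ge0 => //; apply: mulr_ge0; [rewrite subr_ge0|exact: ltW].
have -> : a0 * ((1 - dl) * lam * l) = a0 * lam * l - a0 * lam * (dl * l) by ring.
have A1 : a0 * lam * (dl * l) <= 2 * (dl * l) by rewrite ler_wpM2r ?mulr_ge0.
(* The main term [lam^-1 * lam * l] is exactly [l], which will balance the number of sites in a
   block. *)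
have -> : a0 * lam * l = l - m * (x * D + 4 * q * x ^+ 2).
  by rewrite /a0 /m; field; rewrite !gt_eqF.
have A2 : m * (x * D + 4 * q * x ^+ 2) <=
       m * (D * K + D * sigma * H + 4 * K + 4 * tau ^+ 2 * H).
  rewrite ler_wpM2l //.
  have : 4 * q * x ^+ 2 <= 2 * x ^+ 2.
    by rewrite ler_wpM2r ?sqr_ge0 //; move: q1; clear; lra.
  by rewrite /x; move: x2; rewrite /x; clear; lra.
by move: A1 A2; clear; lra.
Qed.

Lemma exponent_ge (q D tau sigma e k K H lam l dl a b n0 n1 : R) :
  0 < q -> D = 1 - 2 * q -> 0 < D -> 0 < lam -> lam * D <= 1 ->
  0 < e -> e <= 1 -> 0 < tau -> tau <= q / 16 -> tau <= D * e / 16 ->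
  `|sigma| = tau ->
  0 < K -> K <= tau -> 0 < H -> H <= 1 -> 0 <= k -> k * H <= K ->
  0 <= l -> 0 <= dl -> dl <= 1 ->
  lam^-1 - (K + sigma * H) * D / (2 * q) - 2 * (K + sigma * H) ^+ 2 <= a ->
  D * (sigma / (1 + k)) - 2 * (sigma / (1 + k)) ^+ 2 <= b ->
  (1 - dl) * lam * l <= n0 -> 0 <= n1 ->
  (0 < sigma -> (1 + e) * (H / (2 * q) * lam * l) <= n1) ->
  (sigma < 0 -> n1 <= (1 - e) * (H / (2 * q) * lam * l)) ->
  l + lam * l / (2 * q) * (D * tau * e / 2 * H - 7 * K) - 2 * dl * l
    <= a * n0 + b * n1.
Proof.
move=> q0 DE D0 lam0 lamD e0 e1 tau0 tauq tauD sE K0 Kt H0 H1 k0 kH l0 d0 d1.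
move=> a_ge b_ge n0_ge n1_ge0.
have D1 : D <= 1 by rewrite DE; move: q0; clear; lra.
have t16 : tau <= 1 / 16 by move: tauq D0; rewrite DE; clear; lra.
have m0 : 0 <= lam * l / (2 * q) by rewrite divr_ge0 ?mulr_ge0 // ltW.
have -> : H / (2 * q) * lam * l = lam * l / (2 * q) * H.
  by field; rewrite gt_eqF.
move=> n1p n1m.
have A := origin_exponent_ge _ _ _ _ _ _ _ _ _ _ _ _ q0 DE D0 lam0 lamD e1 tau0
  tauq tauD sE K0 Kt H0 H1 l0 d0 d1 a_ge n0_ge.
have B := neighbour_exponent_ge _ _ _ _ _ _ _ _ _ _ D0 D1 e0 e1 tau0 t16 tauD sE
  K0 H0 k0 kH m0 b_ge n1_ge0 n1p n1m.
apply: le_trans (lerD A B).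
(* The terms [D * sigma * H] of the two sites cancel. The gain [e * D * tau * H] remains, and
   [tau <= D * e / 16] keeps the quadratic terms below half of it. *)
have : D * tau * e / 2 * H - 7 * K <=
  H * (D * sigma + e * D * tau - 4 * tau ^+ 2) - 2 * K -
  (D * K + D * sigma * H + 4 * K + 4 * tau ^+ 2 * H).
  have h1 : 8 * tau ^+ 2 * H <= D * e / 2 * tau * H.
    rewrite ler_wpM2r ?(ltW H0) // expr2 mulrA ler_wpM2r ?(ltW tau0) //.
    by move: tauD; clear; lra.
  have h2 : D * K <= K by rewrite ler_piMl // ltW.
  by move: h1 h2; clear; lra.
by move=> /(ler_wpM2l m0); clear; lra.
Qed.

End RealInequalities.

(** * Logarithms of the tilting parameters *)

Section TiltBounds.
Context {R : realType} (p q : R).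
Hypotheses (q0 : 0 < q) (qp : q < p) (pq : p + q = 1).

Local Notation D := (1 - 2 * q).

(** In a round trip between 0 and [z] only the leg against the drift costs anything; this makes the
    estimates symmetric in the sign of [z]. *)
Lemma hitting_opp z : hitting p q z * hitting p q (- z) = (q / p) ^+ `|z|%N.
Proof.
case: z => [[|n]|n].
- by rewrite oppr0 /= !expr0 mulr1.
- by rewrite -NegzE /= mulr1.
- by rewrite NegzE opprK /= mul1r.
Qed.

Lemma tilt0E (K sigma : R) (z : int) : z != 0 ->
  tilt0 p q K sigma z =
  (1 + (K + sigma * (q / p) ^+ `|z|%N)) / (2 * q + (K + sigma * (q / p) ^+ `|z|%N)).
Proof.
move=> z0; have E : excessive p q K (sigma * hitting p q z) z 0 =
    2 * q + (K + sigma * (q / p) ^+ `|z|%N).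
  rewrite /excessive /returning sub0r oppr_eq0 (negbTE z0) eqxx mulr0 subr0.
  by rewrite -mulrA hitting_opp /= expr0 mulr1; ring.
by rewrite /tilt0 E; congr (_ / _); ring.
Qed.

Lemma tiltzE (K sigma : R) (z : int) : z != 0 ->
  tiltz p q K sigma z =
  (1 + K / hitting p q z + sigma) / (1 + K / hitting p q z + 2 * q * sigma).
Proof.
move=> z0; have p0 : 0 < p by exact: lt_trans qp.
have H0 : hitting p q z != 0 by rewrite gt_eqF // hitting_gt0.
have E : excessive p q K (sigma * hitting p q z) z z =
    hitting p q z * (1 + K / hitting p q z + 2 * q * sigma).
  rewrite /excessive /returning subrr eqxx (negbTE z0) mulr0 subr0 /= expr0 mulr1.
  by field.
rewrite /tiltz E.
rewrite (_ : _ + _ * D = hitting p q z * (1 + K / hitting p q z + sigma)).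
  by rewrite -mulf_div divff // mul1r.
by field.
Qed.

(** Taking [2 * q] out of the denominator yields [- ln (2 * q)], the inverse of [lambda0 q]; what is
    left is [ln_div_ge] at [x] and [x / (2 * q)]. *)
Lemma ln_tilt0_ge (K sigma : R) (z : int) : z != 0 ->
  let x := K + sigma * (q / p) ^+ `|z|%N in
  - (1 / 2) <= x -> - q <= x ->
  - ln (2 * q) - x * D / (2 * q) - 2 * x ^+ 2 <= ln (tilt0 p q K sigma z).
Proof.
move=> z0 x x1 x2; have q2 : 0 < 2 * q by rewrite mulr_gt0.
have y1 : -1 < x / (2 * q) by rewrite ltr_pdivlMr //; lra.
have qn : q != 0 by rewrite gt_eqF.
have x3 : 1 + x / (2 * q) = (2 * q + x) / (2 * q) by field.
have -> : tilt0 p q K sigma z = (1 + x) / (1 + x / (2 * q)) / (2 * q).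
  have sx : 2 * q + x != 0 by rewrite gt_eqF //; lra.
  rewrite tilt0E // -/x x3; move: (x) sx => y yn.
  by field; rewrite qn yn.
rewrite [leRHS]ln_div ?posrE //; last by rewrite divr_gt0 //; lra.
have := ln_div_ge x (x / (2 * q)) x1 y1.
have -> : x * D / (2 * q) = x / (2 * q) - x by field.
lra.
Qed.

Lemma ln_tiltz_ge (K sigma : R) (z : int) : 0 < K -> z != 0 ->
  let s := sigma / (1 + K / hitting p q z) in
  - (1 / 2) <= s -> D * s - 2 * s ^+ 2 <= ln (tiltz p q K sigma z).
Proof.
move=> K0 z0 s s1; have p0 : 0 < p by exact: lt_trans qp.
have k0 : 0 < 1 + K / hitting p q z.
  by rewrite addr_gt0 // divr_gt0 // hitting_gt0.
have q1 : q < 1 / 2 by move: qp pq; lra.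
have y1 : -1 < 2 * q * s by move: q0; nra.
rewrite tiltzE // (_ : _ / _ = (1 + s) / (1 + 2 * q * s)).
  by have := ln_div_ge s (2 * q * s) s1 y1; lra.
have E1 : 1 + K / hitting p q z + sigma = (1 + K / hitting p q z) * (1 + s).
  by rewrite /s; move: (1 + _) k0 => k k0; field; rewrite gt_eqF.
have E2 : 1 + K / hitting p q z + 2 * q * sigma =
    (1 + K / hitting p q z) * (1 + 2 * q * s).
  by rewrite /s; move: (1 + _) k0 => k k0; field; rewrite gt_eqF.
by rewrite E1 E2 -mulf_div divff ?mul1r // gt_eqF.
Qed.

Lemma expR_le_tilt (A B t : R) (m n : nat) : 0 < A -> 0 < B ->
  t <= ln A * m%:R + ln B * n%:R -> expR t <= A ^+ m * B ^+ n.
Proof.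
by move=> A0 B0; rewrite -ler_expR expRD !expRM_natr !lnK.
Qed.

End TiltBounds.

Lemma probability_bigsetU_le (R : realType) (d : measure_display)
    (T : measurableType d) (P : probability T R) (I : eqType) (r : seq I)
    (F : I -> set T) (B : R) :
  (forall i, measurable (F i)) -> (forall i, i \in r -> (P (F i) <= B%:E)%E) ->
  (P (\big[setU/set0]_(i <- r) F i) <= ((size r)%:R * B)%:E)%E.
Proof.
move=> mF; elim: r => [|i r IH] FB; first by rewrite big_nil measure0 mul0r.
rewrite big_cons; apply: le_trans (measureU2 _ _ _) _ => //.
  by apply: bigsetU_measurable.
rewrite /= -add1n natrD mulrDl mul1r EFinD; apply: leeD.
  by apply: FB; rewrite mem_head.
by apply: IH => j jr; apply: FB; rewrite inE jr orbT.
Qed.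

(** The site 0 is listed twice, which only enlarges a union bound. *)
Definition ints (n : nat) : seq int :=
  map Posz (iota 0 n.+1) ++ map (fun i => - Posz i) (iota 0 n.+1).

Lemma mem_ints n (y : int) : `|y| <= n%:Z -> y \in ints n.
Proof.
rewrite /ints mem_cat => yn; case: y yn => y yn; apply/orP; [left|right].
  by apply/mapP; exists y => //; rewrite mem_iota; lia.
by apply/mapP; exists y.+1; [rewrite mem_iota; lia|lia].
Qed.

Lemma size_ints n : size (ints n) = (n.+1 + n.+1)%N.
Proof. by rewrite size_cat !size_map size_iota. Qed.

Lemma mem_eventual_event (R : realType) (d : measure_display) (T : measurableType d)
    (X : nat -> T -> R) (w : T) (Q : pred (seq bool)) :
  regular X w -> (\forall N \near \oo, Q (signs X w N)) -> eventual_event X Q w.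
Proof.
move=> rw [N _ NQ]; exists N => // n /= Nn.
by apply: mem_word_event => //; exact: NQ.
Qed.

(** * Deviations over dyadic blocks *)

Section Deviation.
Context {R : realType} {d : measure_display} {T : measurableType d}.
Context (P : probability T R) (X : nat -> T -> R) (p q c eps : R).
Hypotheses (q0 : 0 < q) (qp : q < p) (pq : p + q = 1).
Hypothesis hX : iid_steps P X p q.
Hypotheses (c0 : 0 < c) (ac1 : alpha p q * c < 1).
Hypotheses (eps0 : 0 < eps) (eps1 : eps <= 1).

Local Notation h := (q / p).
Local Notation D := (1 - 2 * q).
Local Notation lam := (lambda0 q).
Local Notation g := (alpha p q * c).

Let p0 : 0 < p. Proof. exact: lt_trans qp. Qed.
Let q1 : q < 1 / 2. Proof. by move: qp pq; lra. Qed.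
Let D0 : 0 < D. Proof. by move: q1; lra. Qed.
Let h0 : 0 < h. Proof. exact: divr_gt0. Qed.
Let h1 : h < 1. Proof. by rewrite ltr_pdivrMr // mul1r. Qed.

Let alphaE : alpha p q = - ln h.
Proof. by rewrite /alpha /hh div1r lnV. Qed.

Let alpha0 : 0 < alpha p q.
Proof. by rewrite alphaE oppr_gt0 ln_lt0 // h0. Qed.

Let g0 : 0 < g. Proof. exact: mulr_gt0. Qed.

Let lamV : lam^-1 = - ln (2 * q).
Proof. by rewrite /lambda0 mulN1r invrN invrK. Qed.

Let ln2q : ln (2 * q) < 0.
Proof. by apply: ln_lt0; rewrite mulr_gt0 //=; move: q1; lra. Qed.

Let lam0 : 0 < lam.
Proof. by rewrite -invr_gt0 lamV oppr_gt0. Qed.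

Let lamD : lam * D <= 1.
Proof.
rewrite mulrC -ler_pdivlMr // mul1r lamV.
have E : 1 + (2 * q - 1) = 2 * q by ring.
have : -1 < 2 * q - 1 by move: q0; lra.
by move/le_ln1Dx; rewrite E; lra.
Qed.

(** The product form meets both requirements of [exponent_ge] for [e = eps / 2]: at most [q / 16]
    and at most [D * (eps / 2) / 16]. *)
Definition tau : R := D * (eps / 2) * q / 16.

(** Normalized so that the gain in [exponent_ge] is [rate / 2 * l * H]. *)
Definition rate : R := lam * (D * tau * (eps / 2) / 2) / q.

Definition logblock (k : nat) : R := k%:R * ln 2.

(** The first term cancels the 2^k positions of a block, the second makes the probabilities
    summable, and the third is the loss [7 * K] of [exponent_ge] for [K] the inverse of
    [logblock k]. *)
Definition threshold (k : nat) : R :=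
  logblock k + rate / 8 * logblock k `^ (1 - g) - 7 * lam / (2 * q).

(* The index [i] is [((x, z), sigma)], and [K] is [1 / logblock k]. *)
Definition heavy (k : nat) (i : int * int * R) : pred (seq bool) := fun s =>
  expR (threshold k) <=
  tilt0 p q (logblock k)^-1 i.2 i.1.2 ^+ visits 0 s i.1.1 *
  tiltz p q (logblock k)^-1 i.2 i.1.2 ^+ visits 0 s (i.1.1 + i.1.2).

(** A crude cover of the window, through [ln L <= L <= k + 1]; a number of offsets linear in [k] is
    affordable. *)
Definition radius (k : nat) : nat := ((Num.truncn c).+1 * k.+1)%N.

(** The offset 0 is left out because the two tilted sites must differ; the center is treated by the
    tilt 0. *)
Definition sites (k : nat) : seq (int * int * R) :=
  [seq (y, s) | y <- [seq (x, z) | x <- ints (2 ^ k.+1),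
                                   z <- [seq z <- ints (radius k) | z != 0]],
                s <- [:: tau; - tau; 0]].

Definition bad (k : nat) : set T :=
  \big[setU/set0]_(i <- sites k) eventual_event X (heavy k i).

Let tau0 : 0 < tau.
Proof. by rewrite /tau !(mulr_gt0, divr_gt0). Qed.

Let tauq : tau <= q / 16.
Proof.
rewrite /tau ler_pM2r // ler_piMl ?(ltW q0) // mulr_ile1 ?(ltW D0) //.
- by rewrite divr_ge0 // ltW.
- by move: q0; lra.
- by move: eps1; lra.
Qed.

Let tauD : tau <= D * (eps / 2) / 16.
Proof.
rewrite /tau ler_pM2r // ler_piMr //; first by apply: ltW; rewrite !(mulr_gt0, divr_gt0).
by move: q1; lra.
Qed.

Let rate0 : 0 < rate.
Proof.
apply: divr_gt0 => //; apply: mulr_gt0 => //; apply: divr_gt0 => //.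
by apply: mulr_gt0; [exact: mulr_gt0|exact: divr_gt0].
Qed.

Let rate_eps : rate <= eps.
Proof.
rewrite /rate ler_pdivrMr //.
have : lam * (D * tau * (eps / 2) / 2) = (lam * D) * (tau * (eps / 4)) by field.
move=> ->; apply: (@le_trans _ _ (1 * (tau * (eps / 4)))).
  by rewrite ler_wpM2r // mulr_ge0 ?(ltW tau0) // divr_ge0 // ltW.
rewrite mul1r mulrC -mulrA; apply: ler_wpM2l; first exact: ltW.
by move: tauq q0; lra.
Qed.

Lemma ln2_bounds : 1 / 2 <= ln 2 :> R /\ ln 2 <= 1 :> R.
Proof.
have E : (2 : R)^-1 = 1 + (- 2^-1) by field.
have E' : 2 = 1 + 1 :> R by [].
have A : -1 < - 2^-1 :> R by lra.
have B : -1 < 1 :> R by lra.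
split; last by rewrite [X in ln X]E'; exact: le_ln1Dx.
by have := le_ln1Dx A; rewrite -E lnV ?posrE //; lra.
Qed.

Lemma logblock_bounds k : (0 < k)%N ->
  k.+1%:R / 4 <= logblock k /\ logblock k <= k%:R.
Proof.
move=> k0; have [l1 l2] := ln2_bounds.
have k1 : 1 <= k%:R :> R by rewrite ler1n.
rewrite /logblock -natr1; split; last by rewrite ler_piMr.
have : k%:R * (1 / 2) <= k%:R * ln 2 :> R by rewrite ler_wpM2l.
lra.
Qed.

Lemma expR_logblock k : expR (logblock k) = 2 ^+ k.
Proof. by rewrite /logblock expRM_natl lnK // posrE. Qed.

Lemma measurable_bad k : measurable (bad k).
Proof. by apply: bigsetU_measurable => i _; exact: (measurable_eventual_event P X p q hX). Qed.

Lemma mem_sites k x z s : ((x, z), s) \in sites k ->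
  z != 0 /\ `|s| <= q.
Proof.
have tq : tau <= q by move: tauq q0; lra.
case/allpairsP => -[y s'] [+ + [ey ->]].
rewrite -[X in X \in _ -> _]/y -ey => /allpairsP[[x' z'] [_ + [_ ez]]].
rewrite -[X in X \in _ -> _]/z' -ez mem_filter => /andP[zn _].
rewrite -[X in X \in _ -> _]/s' => ss; split => //; move: ss.
rewrite !inE => /or3P[] /eqP ->; rewrite ?normrN ?normr0 ?(ltW q0) //.
  by rewrite gtr0_norm.
by rewrite gtr0_norm.
Qed.

Lemma size_sites k :
  (size (sites k))%:R <=
  36 * 2 ^+ k * ((Num.truncn c).+2%:R * k.+1%:R) :> R.
Proof.
rewrite !size_allpairs size_ints.
have sz : (size [seq z <- ints (radius k) | z != 0%R] <= 2 * ((Num.truncn c).+2 * k.+1))%N.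
  rewrite size_filter; apply: leq_trans (count_size _ _) _.
  rewrite size_ints /radius [X in (_ <= _ * X)%N]mulSn.
  move: (_ * k.+1)%N => m.
  by rewrite addnn -mul2n leq_mul2l /= addSn ltnS leq_addl.
apply: (@le_trans _ _
  ((6 * 2 ^ k) * (2 * ((Num.truncn c).+2 * k.+1)) * 3)%N%:R).
  rewrite ler_nat leq_mul2r /= leq_mul //.
  have : (0 < 2 ^ k)%N by rewrite expn_gt0.
  by rewrite expnS; move: (2 ^ k)%N => a; clear; lia.
by rewrite !natrM natrX; lra.
Qed.

(** Union bound: the number of sites is of order 2^k (k+1), each costing at most
    [3 * logblock k * expR (- threshold k)]. The powers of 2 cancel and the stretched exponential
    remains. *)
Lemma probability_bad : exists C,
  \forall k \near \oo, (P (bad k) <= (C / (k.+1%:R * k.+2%:R))%:E)%E.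
Proof.
have r8 : 0 < rate / 8 by rewrite divr_gt0.
have g1 : 0 < 1 - g by rewrite subr_gt0.
have [C HC] := expR_stretched_decay (rate / 8) (1 - g) r8 g1.
pose c3 := expR (7 * lam / (2 * q)).
pose M : R := (Num.truncn c).+2%:R.
exists (2 * (36 * (3 * (256 * (M * C * c3))))).
exists 4%N => // k /= k4.
have k0 : (0 < k)%N by exact: leq_trans k4.
have [lk kl] := logblock_bounds k k0.
have l1 : 1 <= logblock k.
  apply: le_trans lk; rewrite ler_pdivlMr // mul1r ler_nat.
  exact: leq_trans k4 _.
have l0 : 0 < logblock k by exact: lt_le_trans l1.
have E0 : 0 < expR (threshold k) by exact: expR_gt0.
apply: le_trans (probability_bigsetU_le _ _ _ P _ _ _
  (3 / ((logblock k)^-1 * expR (threshold k))) _ _) _.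
- by move=> i; exact: (measurable_eventual_event P X p q hX).
- move=> [[x z] s] /mem_sites[zn sq]; apply: (probability_eventual_event P X p q hX) => N.
  apply: (words_chernoff p q q0 qp pq (logblock k)^-1 s z _ _ sq zn N x) => //.
  + by rewrite invr_gt0.
  + by rewrite invf_le1.
rewrite lee_fin.
have C0 : 0 <= C.
  have := HC 1 (lexx 1); rewrite expr1n divr1; apply: le_trans; exact: expR_ge0.
have K1 : 0 < k.+1%:R :> R by rewrite ltr0n.
(* One factor [k.+1] bounds 1/K, and 256 is 4^4, from [k.+1%:R / 4 <= logblock k]. *)
have EE : 3 / ((logblock k)^-1 * expR (threshold k)) <=
    3 * k.+1%:R * ((2 ^+ k)^-1 * (C * 256 / k.+1%:R ^+ 4) * c3).
  have E1 : expR (- threshold k) =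
      (2 ^+ k)^-1 * expR (- (rate / 8 * logblock k `^ (1 - g))) * c3.
    by rewrite /threshold opprB addrC opprD !expRD (expRN (logblock k)) expR_logblock.
  have -> : 3 / ((logblock k)^-1 * expR (threshold k)) =
      3 * logblock k * expR (- threshold k).
    by rewrite invfM invrK -expRN [LHS]mulrA.
  rewrite E1.
  apply: ler_pM.
  - by rewrite mulr_ge0 // ltW.
  - by rewrite -E1 expR_ge0.
  - by rewrite ler_wpM2l // (le_trans kl) // ler_nat.
  rewrite ler_wpM2r ?expR_ge0 // ler_wpM2l ?invr_ge0 ?exprn_ge0 //.
  apply: le_trans (HC _ l1) _.
  rewrite -mulrA ler_wpM2l // ler_pdivlMr ?exprn_gt0 // mulrC.
  rewrite ler_pdivrMr ?exprn_gt0 //.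
  have -> : 256 * logblock k ^+ 4 = (4 * logblock k) ^+ 4.
    by move: (logblock k) => l; ring.
  apply: lerXn2r; rewrite ?nnegrE //; first by rewrite mulr_ge0 // ltW.
  by move: lk; lra.
apply: le_trans (ler_pM _ _ (size_sites k) EE) _ => //.
  by rewrite divr_ge0 // mulr_ge0 ?invr_ge0 ?(ltW l0) // ltW.
have -> : 36 * 2 ^+ k * ((Num.truncn c).+2%:R * k.+1%:R) *
    (3 * k.+1%:R * ((2 ^+ k)^-1 * (C * 256 / k.+1%:R ^+ 4) * c3)) =
    (36 * (3 * (256 * (M * C * c3)))) / k.+1%:R ^+ 2.
  have a0 : 2 ^+ k != 0 :> R by rewrite expf_neq0.
  have b0 : k.+1%:R != 0 :> R by rewrite gt_eqF.
  rewrite /M; move: (2 ^+ k) (k.+1%:R) a0 b0 ((Num.truncn c).+2%:R) => a b a0 b0 m.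
  by field; rewrite a0 b0.
set U := 36 * (3 * (256 * (M * C * c3))).
have U0 : 0 <= U.
  do 3 (apply: mulr_ge0; first exact: ler0n).
  by apply: mulr_ge0; [apply: mulr_ge0 => //; exact: ler0n|exact: expR_ge0].
have k1 : 1 <= k.+1%:R :> R by rewrite ler1n.
rewrite -[k.+2%:R]natr1; move: U (k.+1%:R) U0 K1 k1 => U b U0 b0 b1.
(* The factor 2 turns the inverse square into the telescoping form, as [b + 1 <= 2 * b]. *)
have -> : 2 * U / (b * (b + 1)) = U * (2 / (b * (b + 1))) by rewrite [2 * U]mulrC -mulrA.
apply: ler_wpM2l => //.
rewrite ler_pdivlMr ?mulr_gt0 ?addr_gt0 // mulrC ler_pdivrMr ?exprn_gt0 //.
have : b <= b * b by rewrite ler_peMr // ltW.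
by rewrite expr2; lra.
Qed.

Lemma not_bad w k x z s : regular X w -> ~ bad k w ->
  `|x| <= (2 ^ k.+1)%N%:Z -> z != 0 -> `|z| <= (radius k)%:Z ->
  s \in [:: tau; - tau; 0] -> 0 < logblock k ->
  ~ \forall N \near \oo, threshold k <=
      ln (tilt0 p q (logblock k)^-1 s z) * (visits 0 (signs X w N) x)%:R +
      ln (tiltz p q (logblock k)^-1 s z) * (visits 0 (signs X w N) (x + z))%:R.
Proof.
move=> rw nb xk z0 zk ss l0 [N0 _ H].
have xs : ((x, z), s) \in sites k.
  apply: allpairs_f => //; apply: allpairs_f; first exact: mem_ints.
  by rewrite mem_filter z0 mem_ints.
have [_ sq] := mem_sites _ _ _ _ xs.
apply: nb; rewrite /bad -bigcup_seq; exists ((x, z), s) => //.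
apply: mem_eventual_event => //; exists N0 => // N /= /H.
have [] // := tilt_gt0 p q q0 qp pq (logblock k)^-1 s z; first by rewrite invr_gt0.
exact: expR_le_tilt.
Qed.

(** With [h = expR (- alpha p q)], the edge [c * ln L] of the window gives exactly [L] to the power
    [- g]. *)
Let hitpow (z : int) (L : R) : 1 <= L -> `|z%:~R| <= c * ln L ->
  (L `^ g)^-1 <= h ^+ `|z|%N.
Proof.
move=> L1 zL; have L0 : 0 < L by exact: lt_le_trans L1.
have hE : h = expR (- alpha p q) by rewrite alphaE opprK lnK.
rewrite hE -expRM_natl mulrN expRN lef_pV2 ?posrE ?expR_gt0 ?powR_gt0 //.
rewrite /powR gt_eqF // ler_expR mulrC -mulrA ler_wpM2l ?(ltW alpha0) //.
apply: le_trans zL; rewrite -intr_norm -abszE; exact: lexx.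
Qed.

(** The gain is at least [rate / 4 * l^(1 - g)]: half of it pays for the loss in the level, the
    other half is the second term of [threshold]. *)
Let threshold_le k H : 0 < logblock k -> (2 * logblock k `^ g)^-1 <= H ->
  threshold k <= logblock k +
    lam * logblock k / (2 * q) *
      (D * tau * (eps / 2) / 2 * H - 7 * (logblock k)^-1) -
    2 * (rate / 16 / logblock k `^ g) * logblock k.
Proof.
rewrite /threshold; set l := logblock k => l0 HH.
have -> : l `^ (1 - g) = l / l `^ g.
  by rewrite powRB ?(gt_eqF l0) ?implybT // powRr1 // ltW.
have G0 : 0 < l `^ g by exact: powR_gt0.
move: (l `^ g) G0 HH => G G0 HH.
have l00 : l != 0 by rewrite gt_eqF.
have q00 : q != 0 by rewrite gt_eqF.
have G00 : G != 0 by rewrite gt_eqF.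
have E : lam * l / (2 * q) * (D * tau * (eps / 2) / 2 * H - 7 * l^-1) =
    rate / 2 * l * H - 7 * lam / (2 * q).
  by rewrite /rate; field; rewrite q00 l00.
rewrite E; have : rate / 2 * l * (2 * G)^-1 <= rate / 2 * l * H.
  by apply: ler_wpM2l => //; rewrite mulr_ge0 ?(ltW l0) // divr_ge0 // ltW.
have -> : rate / 2 * l * (2 * G)^-1 = rate / 4 * (l / G) by field.
have -> : 2 * (rate / 16 / G) * l = rate / 8 * (l / G) by field.
lra.
Qed.

Let ratio_le (a V : R) : 0 < V -> (1 - eps) * V <= a -> a <= (1 + eps) * V ->
  `|a / V - 1| <= eps.
Proof.
move=> V0 h1' h2'; rewrite ler_norml lerBrDr lerBlDr.
by rewrite ler_pdivlMr // ler_pdivrMr // addrC h1' addrC h2'.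
Qed.

(** Safe at infinity, where [fine] gives 0; the converse fails there. *)
Let fine_ge (a : \bar R) (r : R) : (0 <= a)%E -> r <= fine a -> (r%:E <= a)%E.
Proof. by case: a => [a||] //= _; rewrite ?lee_fin // leey. Qed.

Let local_time_ge0 w x : (0 <= local_time X w x)%E.
Proof. by apply: nneseries_ge0 => k _ _; rewrite lee_fin. Qed.

(** * Deviations along one path in one block, with [L] in the place of [ln n] *)

Section Block.
Context (w : T) (k : nat) (L dn : R) (x : int).
Hypotheses (rw : regular X w) (nb : ~ bad k w).
Local Notation l := (logblock k).
Hypotheses (l1 : 1 <= l) (ltau : l^-1 <= tau) (leps : l^-1 <= eps / 2).
Hypotheses (lL : l <= L) (Ll : L <= l + 1).
Hypothesis dnL : `|dn| * L `^ g <= rate / 16.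
Hypothesis xk : `|x| <= (2 ^ k.+1)%N%:Z.
Hypothesis xi_ge : (1 - dn) * lam * L <= fine (local_time X w x).

Let l0 : 0 < l. Proof. exact: lt_le_trans l1. Qed.
Let L1 : 1 <= L. Proof. exact: le_trans lL. Qed.
Let L0 : 0 < L. Proof. exact: lt_le_trans L1. Qed.
Let lg1 : 1 <= l `^ g.
Proof.
have := ge0_ler_powR (ltW g0) (x := 1) (y := l).
by rewrite powR1; apply; rewrite ?nnegrE // ltW.
Qed.
Let lgLg : l `^ g <= L `^ g.
Proof. by apply: ge0_ler_powR => //; rewrite ?nnegrE; exact: ltW. Qed.
Let Lglg : L `^ g <= 2 * l `^ g.
Proof.
apply: (@le_trans _ _ ((2 * l) `^ g)).
  apply: ge0_ler_powR; first exact: ltW.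
  - by rewrite nnegrE ltW.
  - by rewrite nnegrE mulr_ge0 // ltW.
  - by move: Ll l1; lra.
rewrite powRM ?(ltW l0) //; apply: ler_wpM2r; first exact: powR_ge0.
by apply: ler1_powR; [rewrite ler1n|exact: ltW].
Qed.
(** A bound for [dn] that depends on the block only, in the form that [threshold_le] can afford. *)
Let dl : R := rate / 16 / l `^ g.
Let dl0 : 0 <= dl.
Proof. by rewrite /dl divr_ge0 ?powR_ge0 // divr_ge0 // ltW. Qed.
Let dl1 : dl <= eps / 16.
Proof.
rewrite /dl ler_pdivrMr ?powR_gt0 //.
apply: (@le_trans _ _ (eps / 16 * 1)); first by move: rate_eps; lra.
by apply: ler_wpM2l => //; rewrite divr_ge0 // ltW.
Qed.
Let dn_dl : dn <= dl.
Proof.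
apply: le_trans (ler_norm dn) _; rewrite /dl ler_pdivlMr ?powR_gt0 //.
by apply: le_trans dnL; apply: ler_wpM2l.
Qed.
Let n0_ge : (1 - dl) * lam * l <= fine (local_time X w x).
Proof.
apply: le_trans xi_ge; apply: ler_pM => //.
- apply: mulr_ge0; last exact: ltW.
  by move: dl1 eps1; lra.
- exact: ltW.
- by apply: ler_wpM2r; [exact: ltW|move: dn_dl; lra].
Qed.

(** The lower bound is the hypothesis on the level. An excess by the factor [1 + eps] would raise
    the exponent by about [eps * l], which exceeds the [rate] term of the threshold. *)
Lemma center_deviation :
  `|fine (local_time X w x) / (lam * L) - 1| <= eps.
Proof.
have V0 : 0 < lam * L by exact: mulr_gt0.
apply: ratio_le => //.
  apply: le_trans xi_ge; rewrite -mulrA; apply: ler_wpM2r; first exact: ltW.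
  by move: dn_dl dl1 eps0; lra.
rewrite leNgt; apply/negP => xi_gt.
(* For [sigma = 0] the tilt at the second site is 1, so any nonzero offset serves. *)
apply: (not_bad w k x 1 0 rw nb xk) => //.
  by rewrite !inE eqxx !orbT.
have B1 : tiltz p q l^-1 0 1 = 1.
  rewrite (tiltzE p q q0 qp) // mulr0 addr0 divff // gt_eqF //.
  by rewrite addr_gt0 // divr_gt0 ?invr_gt0 // hitting_gt0.
have K0 : 0 < l^-1 by rewrite invr_gt0.
have K1 : l^-1 <= 1 / 8 by move: ltau tauq q1; lra.
have := ln_tilt0_ge p q q0 l^-1 0 1 isT.
rewrite mul0r addr0 => /(_ ltac:(move: K0; lra) ltac:(move: K0 q0; lra)) A_ge.
have Lr : (((1 + eps) * (lam * l))%:E <= local_time X w x)%E.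
  apply: fine_ge => //; apply: le_trans (ltW xi_gt).
  apply: ler_wpM2l; first by move: eps0; lra.
  by apply: ler_wpM2l => //; exact: ltW.
have := visits_ge_near X w x _ Lr.
apply: filterS => N n0; rewrite B1 ln1 mul0r addr0.
have tl : threshold k <= l + rate / 8 * l - 7 * lam / (2 * q).
  rewrite /threshold; have : l `^ (1 - g) <= l.
    by apply: ler1_powR => //; rewrite gerBl ltW.
  by move/(ler_wpM2l (ltW (divr_gt0 rate0 (ltr0n R 8)))); lra.
apply: le_trans tl _.
set a := ln _ in A_ge *.
rewrite -lamV in A_ge; set a0 := _ - _ in A_ge.
have De : D * (eps / 2) <= D / 2.
  have : D * (eps / 2) <= D * (1 / 2) by rewrite ler_wpM2l ?(ltW D0) //; move: eps1; lra.
  by lra.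
have KD : l^-1 <= D / 32 by move: ltau tauD De; lra.
have lamVD : D <= lam^-1 by rewrite -[leRHS]mul1r ler_pdivlMr // mulrC.
have q00 : q != 0 by rewrite gt_eqF.
have a00 : 0 <= a0.
  have e1 : l^-1 * D / (2 * q) <= D / 32.
    rewrite ler_pdivrMr ?mulr_gt0 // mulrC.
    have : D * l^-1 <= D * (q / 16) by rewrite ler_wpM2l ?(ltW D0) // (le_trans ltau).
    by lra.
  have e2 : l^-1 ^+ 2 <= l^-1 / 8 by rewrite expr2 ler_wpM2l ?(ltW K0) //; move: K1; lra.
  by rewrite /a0; move: D0 KD; lra.
apply: (@le_trans _ _ (a0 * ((1 + eps) * (lam * l)))); last first.
  apply: ler_pM => //; apply: mulr_ge0; first by move: eps0; lra.
  by rewrite mulr_ge0 // ltW.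
have -> : a0 * ((1 + eps) * (lam * l)) =
    (1 + eps) * l - (1 + eps) * (lam / (2 * q) * (D + 4 * q * l^-1)).
  have ln0 : l != 0 by rewrite gt_eqF.
  have lamn0 : lam != 0 by rewrite gt_eqF.
  rewrite /a0; move: lam l lamn0 ln0 => la m la0 m0.
  by field; rewrite q00 m0 la0.
have Y0 : 0 < lam / (2 * q) by rewrite divr_gt0 // mulr_gt0.
(* The resulting loss, at most [6 * lam / (2 * q)], fits in the constant [7 * lam / (2 * q)] of the
   threshold. *)
have W : lam / (2 * q) * (D + 4 * q * l^-1) <= lam / (2 * q) * 3.
  apply: ler_wpM2l; first exact: ltW.
  have : q * l^-1 <= 1 / 2 * l^-1 by rewrite ler_wpM2r ?(ltW K0) // ltW.
  by move: K1 q0; lra.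
have W2 : (1 + eps) * (lam / (2 * q) * (D + 4 * q * l^-1)) <=
    2 * (lam / (2 * q) * 3).
  apply: ler_pM => //; [by move: eps0; lra| |by move: eps1; lra].
  by rewrite mulr_ge0 ?(ltW Y0) // addr_ge0 ?(ltW D0) // !mulr_ge0 // ltW.
have R1 : rate / 8 * l <= eps * l.
  by apply: ler_wpM2r; [exact: ltW|move: rate_eps rate0; lra].
by move: W2 R1 Y0; lra.
Qed.

Lemma neighbour_deviation z : z != 0 -> `|z%:~R| <= c * ln L ->
  `|fine (local_time X w (x + z)) / (mz p q z * lam * L) - 1| <= eps.
Proof.
move=> zn zL; set H := h ^+ `|z|%N.
have H0 : 0 < H by exact: exprn_gt0.
have H1 : H <= 1 by rewrite exprn_ile1 // ltW.
have q2 : 0 < 2 * q by rewrite mulr_gt0.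
have HH : (2 * l `^ g)^-1 <= H.
  apply: le_trans (hitpow z L L1 zL).
  by rewrite lef_pV2 ?posrE ?mulr_gt0 ?powR_gt0.
have -> : mz p q z * lam * L = H / (2 * q) * lam * L by rewrite /mz (negbTE zn).
have m0 : 0 < H / (2 * q) * lam by rewrite mulr_gt0 // divr_gt0.
set V := _ * L; set v := H / (2 * q) * lam * l.
have V0 : 0 < V by exact: mulr_gt0.
have v0 : 0 < v by exact: mulr_gt0.
have vV : v <= V by rewrite ler_wpM2l // ltW.
(* Passing from [L] to [l] uses up half of [eps]; the tail estimates keep the other half. *)
have Vv : V <= (1 + eps / 2) * v.
  rewrite [leRHS]mulrCA ler_wpM2l ?(ltW m0) // mulrDl mul1r.
  apply: le_trans Ll _; rewrite lerD2l -ler_pdivrMr // mul1r; exact: leps.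
have zr : `|z| <= (radius k)%:Z.
  rewrite -(ler_int R) intr_norm /radius; apply: (le_trans zL).
  apply: (@le_trans _ _ (c * k.+1%:R)).
    apply: ler_wpM2l; first exact: ltW.
    apply: le_trans (ltW (ln_sublinear L0)) (le_trans Ll _).
    have k0 : (0 < k)%N.
      by case: (posnP k) l1 => // ->; rewrite /logblock mul0r ler10.
    by rewrite -natr1 lerD2r; case: (logblock_bounds k k0).
  rewrite -pmulrn natrM ler_wpM2r //; exact/ltW/truncnS_gt.
have K0 : 0 < l^-1 by rewrite invr_gt0.
(* Either tail gives a contradiction. The upper one concerns the full local time; the lower one must
   hold for every prefix. *)
have main s : `|s| = tau ->
    (0 < s -> (((1 + eps / 2) * v)%:E <= local_time X w (x + z))%E) ->
    (s < 0 -> forall N,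
       (visits 0 (signs X w N) (x + z))%:R <= (1 - eps / 2) * v) ->
    False.
  move=> sE sp sm.
  have ss : s \in [:: tau; - tau; 0].
    rewrite !inE; have [s0|s0] := leP 0 s.
      by rewrite -sE ger0_norm // eqxx.
    by rewrite -sE ltr0_norm // opprK eqxx orbT.
  apply: (not_bad w k x z s rw nb xk zn zr ss l0).
  have n0 := visits_ge_near X w x _ (fine_ge _ _ (local_time_ge0 w x) n0_ge).
  have n1 : \forall N \near \oo,
      0 < s -> (1 + eps / 2) * v <= (visits 0 (signs X w N) (x + z))%:R.
    have [s0|s0] := ltP 0 s; last by near=> N.
    by have := visits_ge_near X w (x + z) _ (sp s0); apply: filterS.
  near=> N.
  have E := threshold_le k H l0 HH; apply: le_trans E _.
  have tau1 : tau <= 1 / 16 by move: tauq q1; lra.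
  have sH : `|s * H| <= tau.
    by rewrite normrM sE (gtr0_norm H0) ler_piMr // ltW.
  have k0 : 0 <= l^-1 / hitting p q z.
    by rewrite divr_ge0 ?(ltW K0) // ltW // hitting_gt0.
  have s1 : `|s / (1 + l^-1 / hitting p q z)| <= tau.
    rewrite normrM sE normfV gtr0_norm; last by lra.
    by rewrite ler_piMr ?(ltW tau0) // invf_le1 //; lra.
  move: sH s1; rewrite !ler_norml => /andP[sH1 sH2] /andP[s1 s2].
  apply: (exponent_ge q D tau s (eps / 2) (l^-1 / hitting p q z) (l^-1) H lam l dl
    _ _ (visits 0 (signs X w N) x)%:R (visits 0 (signs X w N) (x + z))%:R) => //.
  - by rewrite divr_gt0.
  - by move: eps1; lra.
  (* The requirement [k * H <= K]: with [k = K / hitting z] the product is [K * hitting (- z)]. *)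
  - rewrite /H -hitting_opp mulrA divfK ?gt_eqF ?hitting_gt0 //.
    by rewrite ler_piMr ?(ltW K0) // hitting_le1.
  - exact: ltW.
  - by move: dl1 eps1; lra.
  - rewrite lamV; apply: (ln_tilt0_ge p q q0 (l^-1) s z zn).
      by move: sH1 K0 tau1; rewrite -/H; lra.
    by move: sH1 K0 tauq q0; rewrite -/H; lra.
  - apply: (ln_tiltz_ge p q q0 qp pq (l^-1) s z K0 zn).
    by move: s1 tau1; lra.
  - by near: N.
  - by near: N.
  - by move/sm; apply.
apply: ratio_le => //; rewrite leNgt; apply/negP => dev.
  (* An infinite local time has [fine] equal to 0 and looks like a lower deviation; it is excluded
     by the upper tail instead. *)
  have [fz|nfz] := boolP (local_time X w (x + z) \is a fin_num).
    apply: (main (- tau)); first by rewrite normrN gtr0_norm.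
      by rewrite oppr_gt0 ltNge (ltW tau0).
    move=> _ N; have := visits_le_local_time X w N (x + z).
    rewrite -(fineK fz) lee_fin => /le_trans; apply; apply: le_trans (ltW dev) _.
    (* [(1 - eps) * (1 + eps / 2) <= 1 - eps / 2]. *)
    apply: (@le_trans _ _ ((1 - eps) * ((1 + eps / 2) * v))).
      by apply: ler_wpM2l Vv; move: eps1; lra.
    rewrite mulrA; apply: ler_wpM2r; first exact: ltW.
    by have := sqr_ge0 eps; rewrite expr2; lra.
  apply: (main tau); [exact: gtr0_norm| |by rewrite ltNge (ltW tau0)] => _.
  move: nfz (local_time_ge0 w (x + z)).
  by case: (local_time X w (x + z)) => //= _ _; rewrite leey.
apply: (main tau); [exact: gtr0_norm| |by rewrite ltNge (ltW tau0)] => _.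
apply: fine_ge => //; apply: le_trans (ltW dev).
apply: ler_pM => //; [|exact: ltW|by move: eps0; lra].
by move: eps0; lra.
Unshelve. all: by end_near.
Qed.

End Block.

Lemma ae_deviation (delta : nat -> R) :
  (fun n : nat => delta n * ln (n%:R) `^ g) @ \oo --> (0 : R) ->
  {ae P, forall w : T, \forall n \near \oo,
     forall j : nat, (j <= n)%N ->
     (1 - delta n) * lam * ln (n%:R) <= xi X (S X j w) w ->
     forall z : int, `|z%:~R| <= c * ln (ln (n%:R)) ->
     `| xi X (S X j w + z%:~R) w / (mz p q z * lam * ln (n%:R)) - 1 | <= eps}.
Proof.
move=> hdelta; have [C HC] := probability_bad.
have nbad := ae_near_notin _ _ _ P bad C measurable_bad HC.
apply: filterS2 (ae_regular P X p q hX pq) nbad => w rw [k0 _ nb].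
have r16 : 0 < rate / 16 by rewrite divr_gt0.
(* A sum, so that [B <= logblock k] gives at once [1 <= l], [l^-1 <= tau] and [l^-1 <= eps / 2]. *)
pose B : R := 1 + tau^-1 + (eps / 2)^-1.
have tauV : 0 < tau^-1 by rewrite invr_gt0.
have epsV : 0 < (eps / 2)^-1 by rewrite invr_gt0 divr_gt0.
(* The factor 4 comes from [k.+1%:R / 4 <= logblock k]. *)
pose k1 := maxn k0.+1 (Num.truncn (4 * B)).+1.
near=> n => j jn xi_ge z zL.
pose k := trunc_log 2 n.
have nk1 : (2 ^ k1 <= n)%N by near: n; exists (2 ^ k1)%N.
have n0 : (0 < n)%N by apply: leq_trans nk1; rewrite expn_gt0.
have kk : (k1 <= k)%N by exact: trunc_log_max.
have /andP[kn nk] : (2 ^ k <= n < 2 ^ k.+1)%N by exact: trunc_log_bounds.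
have k_gt0 : (0 < k)%N by apply: leq_trans kk; rewrite /k1 leq_max.
have [lk _] := logblock_bounds k k_gt0.
have Bl : B <= logblock k.
  apply: le_trans lk; rewrite ler_pdivlMr // mulrC.
  apply: le_trans (ltW (truncnS_gt (4 * B))) _; rewrite ler_nat.
  by apply: leq_trans (leqnSn k); apply: leq_trans kk; rewrite /k1 leq_max leqnn orbT.
have l1 : 1 <= logblock k by apply: le_trans Bl; rewrite /B; lra.
have l0 : 0 < logblock k by exact: lt_le_trans l1.
have ltau : (logblock k)^-1 <= tau.
  by rewrite invf_ple ?posrE //; apply: le_trans Bl; rewrite /B; lra.
have leps : (logblock k)^-1 <= eps / 2.
  by rewrite invf_ple ?posrE ?divr_gt0 //; apply: le_trans Bl; rewrite /B; lra.
have n0' : 0 < n%:R :> R by rewrite ltr0n.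
have lL : logblock k <= ln n%:R.
  by rewrite -ler_expR expR_logblock lnK ?posrE // -natrX ler_nat.
have Ll : ln n%:R <= logblock k + 1.
  apply: (@le_trans _ _ (logblock k.+1)).
    by rewrite -ler_expR expR_logblock lnK ?posrE // -natrX ler_nat ltnW.
  rewrite /logblock -natr1 mulrDl mul1r lerD2l; exact: (ln2_bounds).2.
have dn : `|delta n| * ln n%:R `^ g <= rate / 16.
  rewrite -[X in _ * X]ger0_norm ?powR_ge0 // -normrM.
  near: n; exact: (cvgr0_norm_le _ hdelta).
have xk : `|position X w j| <= (2 ^ k.+1)%N%:Z.
  apply: le_trans (norm_position X w j) _; rewrite lez_nat.
  by apply: leq_trans jn (ltnW nk).
have nbk : ~ bad k w.
  by apply: nb => /=; apply: leq_trans kk; rewrite /k1 leq_max leqnSn.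
rewrite S_position // xi_local_time // in xi_ge.
rewrite S_position // -intrD xi_local_time //.
have [->|zn] := eqVneq z 0.
  rewrite addr0 /mz eqxx mul1r.
  exact: (center_deviation w k (ln n%:R) (delta n)).
exact: (neighbour_deviation w k (ln n%:R) (delta n)).
Unshelve. all: by end_near.
Qed.

End Deviation.

Theorem theorem3p6 (R : realType) (d : measure_display) (T : measurableType d)
  (P : probability T R) (X : nat -> T -> R) (p q c : R) (delta : nat -> R)
  (hq0 : 0 < q) (hqp : q < p) (hp1 : p < 1) (hpq : p + q = 1)
  (hX : iid_steps P X p q)
  (hc : 0 < c) (hac : alpha p q * c < 1)
  (hdelta : (fun n : nat => delta n * ln (n%:R) `^ (alpha p q * c)) @ \oo --> (0 : R)) :
  {ae P, forall w : T, forall eps : R, 0 < eps ->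
     \forall n \near \oo,
       forall j : nat, (j <= n)%N ->
       (1 - delta n) * lambda0 q * ln (n%:R) <= xi X (S X j w) w ->
       forall z : int, `|z%:~R| <= c * ln (ln (n%:R)) ->
       `| xi X (S X j w + z%:~R) w / (mz p q z * lambda0 q * ln (n%:R)) - 1 | <= eps}.
Proof.
have invS_gt0 : forall m : nat, 0 < m.+1%:R^-1 :> R by move=> m; rewrite invr_gt0.
(* The values [m.+1%:R^-1], all at most 1, are countably many and arbitrarily small, so one null set
   serves every [eps]. *)
have H m := ae_deviation P X p q c (m.+1%:R^-1) hq0 hqp hpq hX hc hac (invS_gt0 m)
  ltac:(by rewrite invf_le1 // ler1n) delta hdelta.
have := ae_foralln H; apply: filterS => w Hw eps eps0.
have [m me] : exists m : nat, m.+1%:R^-1 <= eps.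
  exists (Num.truncn eps^-1); rewrite invf_ple ?posrE //.
  exact/ltW/truncnS_gt.
apply: filterS (Hw m) => n Hn j jn xi_ge z zL.
exact: le_trans (Hn j jn xi_ge z zL) me.
Qed.
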